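(* All Nyldon words over $A$ are primitive, and for every primitive word $w$ over $A$ there is exactly one Nyldon word among the conjugates of $w$.
   Context: $A$ is a finite alphabet of cardinality at least $2$ with a total order $<$. $A^*$ is the set of finite words over $A$ (including the empty word $\varepsilon$), $|w|$ is the length of $w$. The lexicographic order $<_{\mathrm{lex}}$ on $A^*$ is the total order given by: $u<_{\mathrm{lex}}v$ if $u$ is a proper prefix of $v$, or there exist letters $i<j$ and a word $p$ such that $pi$ is a prefix of $u$ and $pj$ is a prefix of $v$; $u\le_{\mathrm{lex}}v$ means $u<_{\mathrm{lex}}v$ or $u=v$. Nyldon words are defined recursively on length: every letter (word of length $1$) is Nyldon; a word $w$ of length at least $2$ is Nyldon if and only if there is no sequence $(n_1,\ldots,n_k)$ of Nyldon words with $w=n_1\cdots n_k$, $\max\{|n_1|,\ldots,|n_k|\}<|w|$ and $n_1\le_{\mathrm{lex}}\cdots\le_{\mathrm{lex}}n_k$. The empty word is not Nyldon. Two words $x,y$ are conjugate if $x=uv$ and $y=vu$ for some words $u,v$ (possibly empty). A word is a power if it equals $u^k$ for some word $u$ and some integer $k\ge 2$ (in particular $\varepsilon$ is a power); a word is primitive if it is not a power. *)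

(* Defs.v *)
From HB Require Import structures.
From mathcomp Require Import all_boot all_order.

Set Implicit Arguments.
Unset Strict Implicit.
Unset Printing Implicit Defensive.

Import Order.TTheory.

Section Words.

Context {disp : Order.disp_t} {A : finOrderType disp}.
Implicit Types (u v w x y : seq A) (ns : seq (seq A)).

Definition lex_le u v : bool := ((u : seqlexi A) <= (v : seqlexi A))%O.

Lemma lex_leP u v :
  lex_le u v <->
  u = v \/
  (exists2 s, s <> [::] & v = u ++ s) \/
  (exists i j p, [/\ (i < j)%O, prefix (rcons p i) u & prefix (rcons p j) v]).
Proof.
rewrite /lex_le; split.
  elim: u v => [|a u IH] [|b v] //.
  - by left.
  - by right; left; exists (b :: v).
  rewrite lexi_cons; case: (ltgtP a b) => //= [ab _|<- /IH].
    by right; right; exists a, b, [::]; rewrite /= !eqxx !prefix0s.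
  case=> [->|[[s s0 ->]|[i [j [p [ij pu pv]]]]]].
  - by left.
  - by right; left; exists s.
  - by right; right; exists i, j, (a :: p); rewrite /= !eqxx.
case=> [->|[[s _ ->]|[i [j [p [ij /prefixP[s ->] /prefixP[t ->]]]]]]].
- exact: lexx.
- by elim: u => // a u IH; rewrite /= lexi_cons lexx.
rewrite !cat_rcons; elim: p => [|a p IH]; rewrite /= lexi_cons.
  by rewrite (ltW ij) leNgt ij.
by rewrite lexx.
Qed.

(* [n] bounds the depth of the recursion on the length; since the factors are
   strictly shorter than [w], any [n >= size w] gives the same predicate: see
   [nyldonE] below for the recursive characterization. *)
Fixpoint nyldon_rec (n : nat) w : Prop :=
  if n is n'.+1 then
    size w = 1 \/
    (2 <= size w /\
     ~ exists ns : seq (seq A),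
         [/\ w = flatten ns,
             \max_(v <- ns) size v < size w,
             sorted lex_le ns
           & forall v, v \in ns -> nyldon_rec n' v])
  else False.

Definition nyldon w : Prop := nyldon_rec (size w) w.

Lemma nyldon_rec_stable m n w :
  size w <= m -> size w <= n -> nyldon_rec m w <-> nyldon_rec n w.
Proof.
elim: m n w => [|m IH] [|n] w //=.
- by rewrite leqn0 => /eqP -> _; split=> // -[|[]].
- by move=> _; rewrite leqn0 => /eqP ->; split=> // -[|[]].
move=> wm wn.
have E ns v : \max_(v <- ns) size v < size w -> v \in ns ->
    nyldon_rec m v <-> nyldon_rec n v.
  move=> lt vns; have vw : size v < size w.
    exact: leq_ltn_trans (leq_bigmax_seq _ vns isT) lt.
  by apply: IH; rewrite -ltnS; [apply: leq_trans wm|apply: leq_trans wn].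
split=> -[|[w2 H]]; [by left| |by left|]; right; split=> // -[ns [e lt s N]];
  apply: H; exists ns; split=> // v vns; exact/(E ns v lt vns)/N.
Qed.

Lemma nyldonE w :
  nyldon w <->
  size w = 1 \/
  (2 <= size w /\
   ~ exists ns : seq (seq A),
       [/\ w = flatten ns,
           \max_(v <- ns) size v < size w,
           sorted lex_le ns
         & forall v, v \in ns -> nyldon v]).
Proof.
apply: (iff_trans (nyldon_rec_stable (leqnn (size w)) (leqnSn _))) => /=.
have E ns v : \max_(v <- ns) size v < size w -> v \in ns ->
    nyldon_rec (size w) v <-> nyldon v.
  move=> lt vns; apply: nyldon_rec_stable => //; apply: leq_trans (ltnW lt).
  exact: leq_bigmax_seq.
split=> -[|[w2 H]]; [by left| |by left|]; right; split=> // -[ns [e lt s N]];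
  apply: H; exists ns; split=> // v vns; exact/(E ns v lt vns)/N.
Qed.

Definition conjugate x y : Prop := exists u v, x = u ++ v /\ y = v ++ u.

Definition is_power w : Prop :=
  exists u k, 2 <= k /\ w = flatten (nseq k u).

Definition primitive w : Prop := ~ is_power w.

End Words.

(* Main.v *)
Require Import Defs.
From HB Require Import structures.
From mathcomp Require Import all_boot all_order.

(** Every word [w] has a nondecreasing factorization [nfact w] into Nyldon
    words, computed from right to left: a new letter, put in front of the
    factors found so far, swallows its right neighbours for as long as it
    exceeds them.  A word is Nyldon exactly when this yields one factor
    ([nyldonP]), because [nfact] recovers every nondecreasing list of such words
    from its concatenation ([nfact_flatten]).

    The conjugacy statement rests on one inequality ([first_factor_gt]): if a
    Nyldon word [h] exceeds [t] and every factor of [w] is at least [t], then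
    the first factor of [h ++ w] still exceeds [t].  Hence the words whose
    factors are all at least [t] are closed under concatenation, so that if the
    first factor of [x] is at most that of [y], then [x ++ y] starts with the
    same factor as [x] ([nfact_cat_first]).

    At most one Nyldon conjugate, and primitivity.  Let [x] and [y] be nonempty,
    and say that the first factor of [x] is at most that of [y]; then it is also
    the first factor of [x ++ y], which is therefore not Nyldon.  So [x ++ y] and
    [y ++ x] are never both Nyldon ([nyl_not_conjugate]), which excludes two
    Nyldon conjugates, and a Nyldon power when [y] is a power of [x].

    At least one Nyldon conjugate.  Take a conjugate of [w] whose first factor
    [t] is as large as possible, and let [l] be its last factor.  If [l > t],
    moving [l] to the front gives a conjugate with a larger first factor, by the
    inequality above.  So [l = t], all factors equal [t], and by primitivity
    there is just one: this conjugate is Nyldon. *)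

Set Implicit Arguments.
Unset Strict Implicit.
Unset Printing Implicit Defensive.

Import Order.TTheory.

Section Nyldon.

Context {disp : Order.disp_t} {A : finOrderType disp}.
Implicit Types (a : A) (h l m n p s t u v w x y z : seq A).
Implicit Types (st ns : seq (seq A)).

(** * The lexicographic order *)

Lemma lex_le_refl : reflexive (@lex_le disp A).
Proof. by move=> u; rewrite /lex_le lexx. Qed.

Lemma lex_le_trans : transitive (@lex_le disp A).
Proof. by move=> v u w; rewrite /lex_le; apply: le_trans. Qed.

Lemma lex_le_anti u v : lex_le u v -> lex_le v u -> u = v.
Proof. by rewrite /lex_le => uv vu; apply: (@le_anti _ (seqlexi A)); rewrite uv vu. Qed.

Lemma lex_leNge u v : ~~ lex_le u v -> lex_le v u.
Proof. by rewrite /lex_le -ltNge => /ltW. Qed.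

Lemma lex_le_cat u v : lex_le u (u ++ v).
Proof.
apply/lex_leP; case: v => [|a v]; first by left; rewrite cats0.
by right; left; exists (a :: v).
Qed.

Lemma lex_sortedE ns : sorted (@lex_le disp A) ns = pairwise (@lex_le disp A) ns.
Proof. exact/sorted_pairwise/lex_le_trans. Qed.

(** * Factorization from right to left *)

Fixpoint absorb n st : seq (seq A) :=
  if st is m :: st' then
    if lex_le n m then n :: st else absorb (n ++ m) st'
  else [:: n].

Fixpoint nfact w : seq (seq A) :=
  if w is a :: w' then absorb [:: a] (nfact w') else [::].

Definition nyl w : bool := nfact w == [:: w].

Lemma absorb_cat n st1 st2 h :
  absorb n st1 = [:: h] -> absorb n (st1 ++ st2) = absorb h st2.
Proof.
elim: st1 n => [n [->] //|m st1 IH n /=].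
by case: ifP => // _; apply: IH.
Qed.

(** The last equation shows the first factor to be Nyldon by itself: what was
    swallowed is swallowed also when nothing follows. *)
Lemma absorb_split n st : exists st1 st2,
  [/\ st = st1 ++ st2, absorb n st = (n ++ flatten st1) :: st2
    & absorb n st1 = [:: n ++ flatten st1]].
Proof.
elim: st n => [|m st IH] n /=; first by exists [::], [::]; rewrite /= cats0.
case: ifP => nm; first by exists [::], (m :: st); rewrite /= cats0.
have [st1 [st2 [-> -> e]]] := IH (n ++ m).
by exists (m :: st1), st2; rewrite /= nm catA.
Qed.

Lemma absorb_rcons n st m h : absorb n (rcons st m) = [:: h] ->
  exists p, [/\ absorb n st = [:: p], ~~ lex_le p m & h = p ++ m].
Proof.
elim: st n => [|m' st IH] n /=; last by case: ifP => // _; apply: IH.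
by case: ifP => // nm [<-]; exists n; rewrite nm.
Qed.

Lemma absorb_sorted n st :
  sorted (@lex_le disp A) st -> sorted (@lex_le disp A) (absorb n st).
Proof.
elim: st n => //= m st IH n p; case: ifP => /= [-> //|_].
exact/IH/(path_sorted p).
Qed.

Lemma flatten_nfact w : flatten (nfact w) = w.
Proof.
elim: w => //= a w IH.
have [st1 [st2 [e -> _]]] := absorb_split [:: a] (nfact w).
by rewrite /= -flatten_cat -e IH.
Qed.

Lemma nfact_sorted w : sorted (@lex_le disp A) (nfact w).
Proof. by elim: w => //= a w; apply: absorb_sorted. Qed.

Lemma nyl_nilF : nyl [::] = false.
Proof. by []. Qed.

(** The last factor [m] of the tail was swallowed by a prefix of [a :: s]
    that exceeded it, and the other factors are at most [m]. *)
Lemma nyl_tail_le a s : nyl (a :: s) -> all (lex_le^~ (a :: s)) (nfact s).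
Proof.
move=> /eqP /=; move: (nfact_sorted s); rewrite lex_sortedE.
case/lastP: (nfact s) => // ns m; rewrite pairwise_rcons => /andP[le_m _].
move=> /absorb_rcons[p [_ /lex_leNge mp ->]].
have mh : lex_le m (p ++ m) := lex_le_trans mp (lex_le_cat p m).
rewrite all_rcons mh; apply: sub_all le_m => v vm; exact: lex_le_trans vm mh.
Qed.

(** Uniqueness of nondecreasing factorizations.  The tail of the first word
    has factors below it, so they form together with the remaining words a
    shorter nondecreasing list, to which the induction applies; the first
    letter then swallows exactly the factors of that tail. *)
Lemma nfact_flatten ns :
  sorted (@lex_le disp A) ns -> all nyl ns -> nfact (flatten ns) = ns.
Proof.
(* The factors of the tail are Nyldon too; both facts are proved together, by
   induction on the length. *)
have [k] := ubnP (size (flatten ns)).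
suff H : (forall ns, size (flatten ns) < k -> sorted (@lex_le disp A) ns ->
             all nyl ns -> nfact (flatten ns) = ns)
      /\ (forall w, size w < k -> all nyl (nfact w)) by apply: (proj1 H).
elim: k {ns} => [|k [IHu IHn]]; first by split.
split=> [[//|[|a s] ns]|[//|a w]]; first by move=> _ _ /andP[].
- rewrite lex_sortedE pairwise_cons -[all nyl _]/(nyl (a :: s) && all nyl ns).
  rewrite [size _]/= ltnS => lt /andP[le_ns s_ns] /andP[ny n_ns].
  have lts : size s < k by apply: leq_trans lt; rewrite ltnS size_cat leq_addr.
  have le_s := nyl_tail_le ny.
  have {IHu}e_s : nfact (s ++ flatten ns) = nfact s ++ ns.
    rewrite -{1}(flatten_nfact s) -flatten_cat; apply: IHu.
    - by rewrite flatten_cat flatten_nfact.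
    - rewrite lex_sortedE pairwise_cat s_ns -lex_sortedE nfact_sorted !andbT.
      apply/allrelP => u v us vns; apply: (lex_le_trans (allP le_s _ us)).
      exact: (allP le_ns).
    - by rewrite all_cat n_ns IHn.
  rewrite /= e_s (@absorb_cat _ _ _ (a :: s)); last exact/eqP.
  by case: ns le_ns {lt s_ns n_ns e_s} => //= m ns /andP[->].
- rewrite /= ltnS => lt.
  have [st1 [st2 [e -> e1]]] := absorb_split [:: a] (nfact w).
  have := IHn w lt; rewrite e all_cat => /andP[n1 n2] /=.
  rewrite n2 andbT /nyl /= IHu ?e1 //.
    by apply: leq_ltn_trans lt; rewrite -(flatten_nfact w) e flatten_cat
      size_cat leq_addr.
  have := nfact_sorted w.
  by rewrite e !lex_sortedE pairwise_cat => /and3P[].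
Qed.

Lemma nfact_nyl w : all nyl (nfact w).
Proof.
elim: w => //= a w IH.
have [st1 [st2 [e -> e1]]] := absorb_split [:: a] (nfact w).
move: IH (nfact_sorted w); rewrite e all_cat lex_sortedE pairwise_cat.
move=> /andP[n1 n2] /and3P[_ s1 _] /=.
by rewrite n2 andbT /nyl /= nfact_flatten ?e1 ?lex_sortedE.
Qed.

Lemma nfact_cons_le n w :
  nyl n -> all (lex_le n) (nfact w) -> nfact (n ++ w) = n :: nfact w.
Proof.
move=> ny le_n; have -> : n ++ w = flatten (n :: nfact w).
  by rewrite /= flatten_nfact.
apply: nfact_flatten; last by rewrite /= ny nfact_nyl.
by rewrite lex_sortedE /= le_n -lex_sortedE nfact_sorted.
Qed.

Lemma nfact_eq0 w : (nfact w == [::]) = (w == [::]).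
Proof.
case: w => //= a w.
by have [st1 [st2 [_ -> _]]] := absorb_split [:: a] (nfact w).
Qed.

Lemma nyl_eq h w : nfact w = [:: h] -> h = w.
Proof. by move=> e; rewrite -(flatten_nfact w) e /= cats0. Qed.

Lemma mem_nfact_size v w : v \in nfact w -> size w <= size v -> nyl w.
Proof.
move=> vw; have nv := allP (nfact_nyl w) _ vw.
have := flatten_nfact w; case/splitPr: vw => st1 st2.
rewrite flatten_cat /= => e; rewrite -{1}e !size_cat addnCA -{2}(addn0 (size v)).
rewrite leq_add2l leqn0 addn_eq0 => /andP[/nilP e1 /nilP e2].
by rewrite -e e1 e2 cats0.
Qed.

(** By uniqueness, a nondecreasing factorization into shorter Nyldon words would
    be [nfact w]; conversely [nfact w] is one unless it is reduced to [w]. *)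
Lemma nyldonP w : nyldon w <-> nyl w.
Proof.
have [k] := ubnP (size w); elim: k w => // k IH w; rewrite ltnS => wk.
have IHn v : size v < size w -> nyldon v <-> nyl v.
  by move=> vw; apply: IH; apply: leq_trans vw wk.
split=> [/nyldonE[|[w2 no]]|nw].
- by case: w {wk IHn} => [|a []] // _; rewrite /nyl /=.
- apply/negPn/negP => nnw; apply: no; exists (nfact w).
  have lt v : v \in nfact w -> size v < size w.
    move=> vw; rewrite ltnNge; apply: contra nnw; exact: mem_nfact_size vw.
  split; first by rewrite flatten_nfact.
  + rewrite (leq_ltn_trans (n := (size w).-1)) ?prednK ?(ltnW w2) //.
    by apply/bigmax_leqP_seq => v vw _; rewrite -ltnS prednK ?lt ?(ltnW w2).
  + exact: nfact_sorted.
  + by move=> v vw; apply/IHn; [apply: lt|apply: (allP (nfact_nyl w))].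
apply/nyldonE; have [w1|w1] := eqVneq (size w) 1; first by left.
right; split.
  by case: w nw w1 {wk IHn} => [|a [|b w]] //.
case=> ns [e lt s_ns n_ns].
have ltv v : v \in ns -> size v < size w.
  move=> vns; apply: leq_ltn_trans lt; exact: leq_bigmax_seq.
have ens : ns = [:: w].
  rewrite -(eqP nw) e nfact_flatten //.
  by apply/allP => v vns; apply/IHn; [apply: ltv|apply: n_ns].
by have := ltv w; rewrite ens inE eqxx ltnn => /(_ isT).
Qed.

(** * First factors of concatenations *)

Lemma nfact_head_le d w : all (lex_le (head d (nfact w))) (nfact w).
Proof.
have := nfact_sorted w; rewrite lex_sortedE.
by case: (nfact w) => //= h st /andP[->]; rewrite lex_le_refl.
Qed.

(** If the factors of the tail of [h] are at most [t], then reading [h] in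
    front of [w] rebuilds [h] before anything of [w] is swallowed, so the first
    factor extends [h].  Otherwise the last factor [l] of the tail exceeds [t],
    and so does the rest [p] of [h], which is Nyldon and exceeds [l]; the
    induction applies to [l] in front of [w], then to [p] in front of
    [l ++ w]. *)
Lemma first_factor_gt h t w :
    nyl h -> ~~ lex_le h t -> all (lex_le t) (nfact w) ->
  ~~ lex_le (head t (nfact (h ++ w))) t.
Proof.
have [k] := ubnP (size h); elim: k h w => // k IH [|a s] w; rewrite ?nyl_nilF //.
rewrite [size _]/= ltnS => sk nh ht tw.
have eh : absorb [:: a] (nfact s) = [:: a :: s] := eqP nh.
have [le_s|] := boolP (all (lex_le^~ t) (nfact s)).
  have e : nfact (s ++ w) = nfact s ++ nfact w.
    rewrite -{1}(flatten_nfact s) -{1}(flatten_nfact w) -flatten_cat.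
    apply: nfact_flatten; last by rewrite all_cat !nfact_nyl.
    rewrite lex_sortedE pairwise_cat -!lex_sortedE !nfact_sorted !andbT.
    apply/allrelP => u v us vw.
    exact: lex_le_trans (allP le_s _ us) (allP tw _ vw).
  rewrite /= e (absorb_cat _ eh).
  have [st1 [st2 [_ -> _]]] := absorb_split (a :: s) (nfact w).
  by apply: contra ht; apply: lex_le_trans; exact: lex_le_cat.
case/allPn => v vs vt.
have := nfact_nyl s; have := nfact_sorted s; have := flatten_nfact s.
move: eh vs; case/lastP: (nfact s) => // st l eh.
rewrite mem_rcons lex_sortedE pairwise_rcons all_rcons flatten_rcons.
move=> vs es /andP[le_l s_st] /andP[nl n_st].
have lt : ~~ lex_le l t.
  move: vs; rewrite inE => /predU1P[<- //|vst].
  by apply: contra vt; apply: lex_le_trans; exact: (allP le_l).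
have [p [ep pl e]] := absorb_rcons eh.
have p_def : p = a :: flatten st.
  have [st1 [st2 [e1 e2 _]]] := absorb_split [:: a] st.
  by move: ep; rewrite e2 => -[<- e3]; rewrite e1 e3 cats0.
have np : nyl p.
  by rewrite /nyl p_def /= nfact_flatten ?lex_sortedE // ep p_def.
have pt : ~~ lex_le p t.
  apply: contra lt => /(lex_le_trans (lex_leNge pl)) //.
have l0 : 0 < size l by case: (l) nl.
have sz : size p + size l = (size s).+1 by rewrite -size_cat -e.
rewrite e -catA; apply: (IH) => //.
  by apply: leq_trans sk; rewrite -sz -addn1 leq_add2l.
have : ~~ lex_le (head t (nfact (l ++ w))) t.
  apply: IH => //; apply: leq_trans sk.
  by rewrite ltnS -es size_cat leq_addl.
move=> /lex_leNge th; apply: sub_all (nfact_head_le t (l ++ w)) => u.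
exact: lex_le_trans.
Qed.

(** Put the factors of [x] in front of [y] one at a time: a factor equal to [t]
    stays a factor, and the others exceed [t]. *)
Lemma nfact_cat_ge t x y : all (lex_le t) (nfact x) ->
  all (lex_le t) (nfact y) -> all (lex_le t) (nfact (x ++ y)).
Proof.
rewrite -{2}(flatten_nfact x); have := nfact_nyl x.
elim: (nfact x) => //= h st IH /andP[nh n_st] /andP[th t_st] ty.
have {IH n_st t_st ty}ge : all (lex_le t) (nfact (flatten st ++ y)) by exact: IH.
rewrite -catA; have [ht|ht] := boolP (lex_le h t).
  move: nh; rewrite (lex_le_anti ht th) => nt.
  by rewrite nfact_cons_le //= lex_le_refl.
have /lex_leNge lt := first_factor_gt nh ht ge.
apply: sub_all (nfact_head_le t (h ++ flatten st ++ y)) => u.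
exact: lex_le_trans.
Qed.

(** The rest of [x] and [y] both have factors at least the first factor of [x],
    hence so does their concatenation: that first factor swallows nothing. *)
Lemma nfact_cat_first x y d : x != [::] ->
    all (lex_le (head d (nfact x))) (nfact y) ->
  head d (nfact (x ++ y)) = head d (nfact x).
Proof.
rewrite -nfact_eq0 => x0 le_y.
have := nfact_head_le d x; have := nfact_nyl x; have := nfact_sorted x.
rewrite -{5}(flatten_nfact x) lex_sortedE.
case: (nfact x) x0 le_y => //= h st _ le_y.
move=> /andP[le_st s_st] /andP[nh n_st] _.
rewrite -catA nfact_cons_le //; apply: nfact_cat_ge => //.
by rewrite nfact_flatten ?lex_sortedE.
Qed.

(** * Conjugacy *)

Lemma nyl_not_conjugate x y : nyl (x ++ y) -> nyl (y ++ x) ->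
  x = [::] \/ y = [::].
Proof.
(* The hypotheses are symmetric in [x] and [y]: compare first factors. *)
wlog le_xy : x y / lex_le (head [::] (nfact x)) (head [::] (nfact y)).
  move=> H; have [le|/lex_leNge le] :=
    boolP (lex_le (head [::] (nfact x)) (head [::] (nfact y))); first exact: H.
  by move=> nxy nyx; case: (H _ _ le nyx nxy) => ->; [right|left].
move=> nxy _; have [->|x0] := eqVneq x [::]; [by left|right].
have ge : all (lex_le (head [::] (nfact x))) (nfact y).
  apply: sub_all (nfact_head_le [::] y) => u; exact: lex_le_trans.
have := nfact_cat_first x0 ge; rewrite (eqP nxy) /= => e.
have := congr1 size (flatten_nfact x).
case: (nfact x) e => [|h st] /=.
  by move=> /eqP; rewrite -size_eq0 size_cat addn_eq0 size_eq0 (negPf x0).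
move=> <-; rewrite !size_cat -addnA -{2}(addn0 (size x)) => /addnI /eqP.
by rewrite addn_eq0 => /andP[/nilP].
Qed.

Lemma nyl_rot_eq i w : nyl w -> nyl (rot i w) -> rot i w = w.
Proof.
rewrite -{1 4}(cat_take_drop i w) /rot => nw nr.
by case: (nyl_not_conjugate nw nr) => ->; rewrite ?cats0.
Qed.

Lemma flatten_nseqC k u : flatten (nseq k u) ++ u = u ++ flatten (nseq k u).
Proof. by elim: k => [|k IH] /=; rewrite ?cats0 // -catA IH. Qed.

Lemma nyl_primitive w : nyl w -> primitive w.
Proof.
move=> nw [u [[|[|k]] [// _ e]]].
have ne : w <> [::] by move=> w0; rewrite w0 in nw.
have ew : w = u ++ flatten (nseq k.+1 u) by [].
have [u0|v0] : u = [::] \/ flatten (nseq k.+1 u) = [::].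
- by apply: nyl_not_conjugate; rewrite ?flatten_nseqC -ew.
- by apply: ne; rewrite e u0; elim: k {e ew}.
by apply: ne; rewrite ew v0 cats0; case: (u) v0.
Qed.

(** Rotating a power of [a :: u] by one letter gives a power of [rcons u a]. *)
Lemma is_power_rot i w : is_power w -> is_power (rot i w).
Proof.
move=> pw; elim: i => [|i IH]; first by rewrite rot0.
have [lt|ge] := ltnP i (size w); last by rewrite rot_oversize // leqW.
rewrite rotS //; case: IH => -[|a u] [k [k2 ->]].
  by exists [::], k; split=> //; elim: (k).
exists (rcons u a), k; split=> //; case: k k2 => //= k _.
rewrite rot1_cons rcons_cat cat_rcons; congr (_ ++ _).
by elim: k => //= k IH; rewrite rcons_cat IH cat_rcons.
Qed.

(** A rotation whose first factor is as large as possible is Nyldon, or all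
    its factors are equal: a last factor exceeding the first could be moved to
    the front. *)
Lemma exists_nyl_rot w : primitive w -> exists i, nyl (rot i w).
Proof.
move=> pw.
pose F (i : 'I_(size w).+1) : seqlexi A := head [::] (nfact (rot i w)).
have [i _ max_i] := @Order.TotalTheory.arg_maxP _ _ _ ord0 xpredT F isT.
exists i; set c := rot i w in max_i *.
have c_max j : lex_le (head [::] (nfact (rot j c))) (head [::] (nfact c)).
  rewrite /c rot_rot_add rot_minn; set j' := minn _ _.
  have lt : j' < (size w).+1 by rewrite ltnS geq_minr.
  exact: (max_i (Ordinal lt) isT).
have ec := flatten_nfact c.
have := nfact_head_le [::] c; have := nfact_nyl c; have := nfact_sorted c.
case E: (nfact c) => [|t st].
  (* [c] is empty, and the empty word is a power. *)
  case: pw; exists [::], 2; split=> //=; apply: size0nil.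
  by rewrite -(size_rot i w) -/c -ec E.
case/lastP: st E => [|st l] E s_c n_c ge_c.
  by have := n_c; rewrite /= andbT (nyl_eq E).
have [lt|lt] := boolP (lex_le l t).
  case: pw.
  have eq_t u : u \in nfact c -> u = t.
    rewrite E => uc; apply: lex_le_anti; last exact: (allP ge_c).
    apply: lex_le_trans lt; move: s_c uc.
    rewrite lex_sortedE -rcons_cons pairwise_rcons mem_rcons inE.
    by move=> /andP[/allP le_l _] /predU1P[->|/le_l //]; apply: lex_le_refl.
  have en : nfact c = nseq (size (nfact c)) t.
    by apply/all_pred1P/allP => u /eq_t ->; rewrite /= eqxx.
  rewrite -(rotK i w) -/c; apply: is_power_rot; exists t, (size (nfact c)).
  by rewrite -en ec E /= size_rcons.
have nl : nyl l by apply: (allP n_c); rewrite inE mem_rcons inE eqxx orbT.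
have e_init : nfact (flatten (t :: st)) = t :: st.
  apply: nfact_flatten.
    move: s_c; rewrite !lex_sortedE -rcons_cons pairwise_rcons.
    by case/andP.
  by move: n_c; rewrite -rcons_cons all_rcons => /andP[].
have ge_init : all (lex_le t) (nfact (flatten (t :: st))).
  by rewrite e_init; move: ge_c; rewrite -rcons_cons all_rcons => /andP[].
case/negP: (first_factor_gt nl lt ge_init).
have := c_max (size (flatten (t :: st))).
rewrite -{1}ec E -rcons_cons flatten_rcons rot_size_cat /=.
by case: (nfact _) => //= _; apply: lex_le_refl.
Qed.

End Nyldon.

Theorem theorem26 (disp : Order.disp_t) (A : finOrderType disp)
    (hA : 2 <= #|A|) :
  (forall w : seq A, nyldon w -> primitive w) /\
  (forall w : seq A, primitive w ->
     exists! v : seq A, conjugate w v /\ nyldon v).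
Proof.
split=> [w /nyldonP|w pw]; first exact: nyl_primitive.
have [i ni] := exists_nyl_rot pw.
exists (rot i w); split.
  by split; [exists (take i w), (drop i w); rewrite cat_take_drop|apply/nyldonP].
move=> v [[x [y [ew ->]]] /nyldonP].
have -> : y ++ x = rot (size x) (rot (size (rot i w) - i) (rot i w)).
  by rewrite -/(rotr i (rot i w)) rotK ew rot_size_cat.
by rewrite rot_rot_add => nv; rewrite (nyl_rot_eq ni nv).
Qed.
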